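(* Let $\mathfrak S$ be a semigroup with unit $1$, let $\mathcal F$ be a linear space, let $\mathcal E$ be a topological linear space, let $\varphi\colon\mathfrak S\to\mathbf L(\mathcal F,\mathcal E)$ be a mapping, and let $\varPhi\colon\mathfrak S\to\mathbf L(\mathcal D)$ be the minimal dilation of $\varphi$ constructed in the context. Let $(\mathfrak s_\alpha)_\alpha$ be a net in $\mathfrak S$ and $\mathfrak s\in\mathfrak S$ be such that for any $\mathfrak t,\mathfrak u\in\mathfrak S$ $$\varphi(\mathfrak t\mathfrak s_\alpha\mathfrak u)f\to\varphi(\mathfrak t\mathfrak s\mathfrak u)f,\quad f\in\mathcal F .$$ Then $$\varPhi(\mathfrak s_\alpha)w\to\varPhi(\mathfrak s)w,\quad w\in\mathcal D,$$ where the convergence is in the Tikhonov topology inherited by $\mathcal D$.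
   Context: All linear spaces are over a common scalar field ($\mathbb R$ or $\mathbb C$). $\mathbf L(\mathcal F,\mathcal E)$ is the space of all linear maps $\mathcal F\to\mathcal E$ and $\mathbf L(\mathcal D)=\mathbf L(\mathcal D,\mathcal D)$. For $\mathfrak s\in\mathfrak S$ and $f\in\mathcal F$ let $\varphi_{\mathfrak s,f}\in\mathcal E^{\mathfrak S}$ be the function $\varphi_{\mathfrak s,f}(\mathfrak t)=\varphi(\mathfrak t\mathfrak s)f$, $\mathfrak t\in\mathfrak S$. Let $\mathcal D\subset\mathcal E^{\mathfrak S}$ be the linear span of all $\varphi_{\mathfrak s,f}$. For $\mathfrak u\in\mathfrak S$, $\varPhi(\mathfrak u)\colon\mathcal D\to\mathcal D$ is the (well defined) linear operator determined by $\varPhi(\mathfrak u)\varphi_{\mathfrak s,f}=\varphi_{\mathfrak u\mathfrak s,f}$. With $T\colon\mathcal F\to\mathcal D$, $Tf=\varphi_{1,f}$, and the linear map $S\colon\mathcal D\to\mathcal E$ determined by $S\varphi_{\mathfrak s,f}=\varphi(\mathfrak s)f$, one has $\varphi(\mathfrak u)=S\varPhi(\mathfrak u)T$, and $\varPhi$ is called the minimal dilation of $\varphi$. The Tikhonov topology of $\mathcal D$ is the topology inherited from the product topology of $\mathcal E^{\mathfrak S}$ (pointwise convergence on $\mathfrak S$). *)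

(* Defs.v *)
From HB Require Import structures.
From mathcomp Require Import all_boot all_order all_algebra complex.
From mathcomp Require Import all_classical all_reals all_analysis.

Set Implicit Arguments.
Unset Strict Implicit.
Unset Printing Implicit Defensive.

Import Order.TTheory GRing.Theory Num.Theory.
Import numFieldNormedType.Exports.

Local Open Scope classical_set_scope.
Local Open Scope ring_scope.

(* The two admissible scalar fields, each carrying (through its norm) the
   usual topology. *)
Variant scalar_kind := RealScalars | ComplexScalars.

Definition scalars (R : realType) (k : scalar_kind) : numFieldType :=
  match k with RealScalars => R | ComplexScalars => R[i]%C end.

Record directed (A : Type) (le : A -> A -> Prop) : Prop := Directed {
  directed_inhabited : inhabited A;
  directed_refl : forall a, le a a;
  directed_trans : forall a b c, le a b -> le b c -> le a c;
  directed_ub : forall a b, exists2 c, le a c & le b c }.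

(* For [directed le], [x @ net_filter le --> l] is the convergence of the net
   [(x a)_a] to [l]. *)
Definition net_filter (A : Type) (le : A -> A -> Prop) : set_system A :=
  [set U | exists a, forall b, le a b -> U b].

Definition lspan (K : numFieldType) (V : lmodType K) (X : set V) : set V :=
  [set v | exists n (c : 'I_n -> K) (x : 'I_n -> V),
     (forall i, X (x i)) /\ v = \sum_(i < n) c i *: x i].

Lemma lspan_sub (K : numFieldType) (V : lmodType K) (X : set V) :
  X `<=` lspan X.
Proof.
move=> v Xv; exists 1%N, (fun=> 1), (fun=> v); split => //.
by rewrite big_ord1 scale1r.
Qed.

Lemma lspan_submod (K : numFieldType) (V : lmodType K) (X : set V) :
  submod_closed (fun v => `[< lspan X v >]).
Proof.
split; first by apply/asboolP; exists 0%N, (fun=> 0), (fun=> 0);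
  split; [case | rewrite big_ord0].
move=> a u v /asboolP[m [c [x [Xx ->]]]] /asboolP[n [d [y [Xy ->]]]].
apply/asboolP; exists (m + n)%N.
exists (fun i => match fintype.split i with inl j => a * c j | inr j => d j end).
exists (fun i => match fintype.split i with inl j => x j | inr j => y j end).
split; first by move=> i; case: (fintype.split i).
rewrite big_split_ord /= scaler_sumr; congr (_ + _); apply: eq_bigr => i _.
  by rewrite (unsplitK (inl i)) scalerA.
by rewrite (unsplitK (inr i)).
Qed.

Section MinimalDilation.
Context {S : monoidType} {K : numFieldType} {F : lmodType K}.
Context {E : topologicalLmodType K} (phi : S -> {linear F -> E}).

(* The function usually written phi_{s,f}; [dspace] below is the linear span
   of these functions, a subspace of S -> E, and [translate] is phi_{s,f} as
   an element of it. *)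
Definition translate_fun (s : S) (f : F) : S -> E :=
  fun t => phi (t * s)%g f.

Definition in_dspace : pred (S -> E) := fun w =>
  `[< lspan [set w' | exists s f, w' = translate_fun s f] w >].

Lemma in_dspace_submod : submod_closed in_dspace.
Proof. exact: lspan_submod. Qed.

HB.instance Definition _ :=
  GRing.isSubmodClosed.Build K (S -> E) in_dspace in_dspace_submod.

Record dspace := DSpace { dval : S -> E; _ : in_dspace dval }.

HB.instance Definition _ := [isSub for dval].
HB.instance Definition _ := [Choice of dspace by <:].
HB.instance Definition _ := [SubChoice_isSubLmodule of dspace by <:].

(* The Tikhonov topology: induced by the product topology of S -> E. *)
HB.instance Definition _ := Topological.copy dspace
  (initial_topology (fun w : dspace => (dval w : {ptws S -> E}))).

Lemma in_translate (s : S) (f : F) : in_dspace (translate_fun s f).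
Proof. by apply/asboolP; apply: lspan_sub; exists s, f. Qed.

Definition translate (s : S) (f : F) : dspace := DSpace (in_translate s f).

Lemma dspace_span (w : dspace) : exists n (c : 'I_n -> K) (s : 'I_n -> S)
  (f : 'I_n -> F), w = \sum_(i < n) c i *: translate (s i) (f i).
Proof.
case: w => w pw; have /asboolP[n [c [x [Xx wE]]]] := pw.
have [s Hs] := choice Xx; have [f Hf] := choice Hs.
exists n, c, s, f; apply: val_inj.
rewrite (raddf_sum (val : dspace -> S -> E)) [LHS]wE.
by apply: eq_bigr => i _; rewrite Hf.
Qed.

Lemma dilation_ex (u : S) : exists A : {linear dspace -> dspace},
  forall s f, A (translate s f) = translate (u * s)%g f.
Proof.
have st (w : dspace) : in_dspace (fun t => dval w (t * u)%g).
  have [n [c [s [f ->]]]] := dspace_span w.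
  apply/asboolP; exists n, c, (fun i => translate_fun (u * s i)%g (f i)).
  split; first by move=> i; exists (u * s i)%g, (f i).
  apply/funext => t; rewrite -[dval _]/(val _).
  rewrite (raddf_sum (val : dspace -> S -> E)) !fct_sumE.
  apply: eq_bigr => i _.
  by rewrite /= /translate_fun /= !fctE /= /translate_fun mulgA.
pose A (w : dspace) := DSpace (st w).
have linA : linear A by move=> a v w; apply: val_inj; apply/funext => t.
pose mA := GRing.isLinear.Build K dspace dspace _ A linA.
pose lA : {linear dspace -> dspace} := HB.pack A mA.
exists lA => s f; apply: val_inj; apply/funext => t.
by rewrite /= /translate_fun mulgA.
Qed.

(* The operator determined by its values [dilationE] on the spanning family;
   see [dilation_unique]. *)
Definition dilation (u : S) : {linear dspace -> dspace} :=
  sval (cid (dilation_ex u)).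

Lemma dilationE (u s : S) (f : F) :
  dilation u (translate s f) = translate (u * s)%g f.
Proof. exact: (svalP (cid (dilation_ex u))). Qed.

Lemma dilation_unique (u : S) (A : {linear dspace -> dspace}) :
  (forall s f, A (translate s f) = translate (u * s)%g f) -> A =1 dilation u.
Proof.
move=> AE w; have [n [c [s [f ->]]]] := dspace_span w.
rewrite !linear_sum; apply: eq_bigr => i _.
by rewrite !linearZ AE dilationE.
Qed.

End MinimalDilation.

(* Main.v *)
Require Import Defs.
From mathcomp Require Import all_boot all_order all_algebra complex.
From mathcomp Require Import all_classical all_reals all_analysis.

Import GRing.Theory numFieldNormedType.Exports.
Local Open Scope classical_set_scope.
Local Open Scope ring_scope.

(** Tikhonov convergence is pointwise convergence on [S] ([initial_cvg], [ptws_cvg]). A vector [w]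
    is a finite combination of [translate phi (r i) (f i)], so at a point [t] the value of
    [dilation phi u w] is the sum of the [c i *: phi (t * u * r i) (f i)] ([dval_dilation]). For
    [u = s_ a] each term converges by hypothesis, and addition and scaling in [E] are continuous. *)

Lemma net_filter_filter (A : Type) (le : A -> A -> Prop) :
  directed le -> Filter (net_filter le).
Proof.
case=> -[a0] _ le_tr le_ub; split; first by exists a0.
- move=> U V [a Ua] [b Vb]; have [c ac bc] := le_ub a b.
  by exists c => d cd; split; [apply: Ua; apply: le_tr cd
                              |apply: Vb; apply: le_tr cd].
- by move=> U V UV [a Ua]; exists a => b /Ua /UV.
Qed.

(** Open sets of the initial topology are the preimages under [f] of open sets of [Y]. *)
Lemma initial_cvg (X : choiceType) (Y : topologicalType) (f : X -> Y)
    (F : set_system X) (x : X) :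
  Filter F -> f y @[y --> F] --> f x -> F --> (x : initial_topology f).
Proof.
move=> FF fFx U /=; rewrite nbhsE => -[V [[W oW WV] Vx] VU].
have : F (f @^-1` W).
  by apply: fFx; apply: open_nbhs_nbhs; split => //; rewrite -WV in Vx.
by rewrite WV; apply: filterS.
Qed.

(** The product topology is the supremum of the initial topologies of the evaluations, so each
    coordinate can be tested separately. *)
Lemma ptws_cvg (I : Type) (Y : topologicalType) (F : set_system (I -> Y))
    (l : I -> Y) :
  Filter F -> (forall i, h i @[h --> F] --> l i) -> {ptws, F --> l}.
Proof. by move=> FF Fl; apply/cvg_sup => i; exact: initial_cvg (Fl i). Qed.

Lemma dval_dilation (S : monoidType) (K : numFieldType) (F : lmodType K)
    (E : topologicalLmodType K) (phi : S -> {linear F -> E}) (n : nat)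
    (c : 'I_n -> K) (s : 'I_n -> S) (f : 'I_n -> F) (u t : S) :
  dval (dilation phi u (\sum_(i < n) c i *: translate phi (s i) (f i))) t =
  \sum_(i < n) c i *: phi (t * u * s i)%g (f i).
Proof.
rewrite linear_sum -[dval _]/(val _) (raddf_sum (val : dspace phi -> S -> E)).
rewrite fct_sumE; apply: eq_bigr => i _.
by rewrite linearZ /= dilationE /= -mulgA.
Qed.

Theorem theorem10 (R : realType) (k : scalar_kind) (S : monoidType)
    (F : lmodType (scalars R k)) (E : topologicalLmodType (scalars R k))
    (phi : S -> {linear F -> E})
    (A : Type) (le : A -> A -> Prop) (s_ : A -> S) (s : S) :
  directed le ->
  (forall (t u : S) (f : F),
     (fun a => phi (t * s_ a * u)%g f) @ net_filter le
       --> phi (t * s * u)%g f) ->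
  forall w : dspace phi,
    (fun a => dilation phi (s_ a) w) @ net_filter le --> dilation phi s w.
Proof.
move=> dir phi_cvg w; have FF := @net_filter_filter _ _ dir.
apply: initial_cvg; apply: ptws_cvg => t.
have [n [c [r [f ->]]]] := dspace_span w.
change ((fun a => dval (dilation phi (s_ a)
    (\sum_(i < n) c i *: translate phi (r i) (f i))) t) @ net_filter le -->
  dval (dilation phi s (\sum_(i < n) c i *: translate phi (r i) (f i))) t).
rewrite dval_dilation; under eq_cvg do rewrite dval_dilation.
apply: cvg_big; first exact: add_continuous.
(* The coefficient is a constant net of scalars; [phi_cvg] is used at [t] and [r i], and joint
   continuity of scaling combines the two limits. *)
move=> i _; apply: continuous2_cvg (cvg_cst (c i : _^o)) (phi_cvg _ _ _).
exact: (@scale_continuous _ _ (c i, _)).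
Qed.
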